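(* Let $H$ be a hypergraph, $B\subseteq V(H)$ and $B^*\subseteq E(H)$. Then $B$ is a lazy burning set for $H$ and $B^*$ is a lazy burning set for $H^*$ if and only if $B\cup B^*$ is a skew zero forcing set for $\mathrm{IG}(H)$. In particular, $z_0(\mathrm{IG}(H))=b_L(H)+b_L(H^* )$.
   Context: A hypergraph $H$ consists of a finite vertex set $V(H)$ and a finite collection $E(H)$ of subsets of $V(H)$ (repeated hyperedges allowed). Lazy burning: a set $B\subseteq V(H)$ is burned initially; in each subsequent round every unburned vertex $v$ for which some hyperedge $h\ni v$ has $h\setminus\{v\}$ entirely burned becomes burned. $B$ is a lazy burning set if eventually all vertices burn; $b_L(H)$ is the minimum size of one. The dual $H^*$ has vertex set $E(H)$ and hyperedges $N(v)=\{h\in E(H): v\in h\}$ for $v\in V(H)$. The incidence graph $\mathrm{IG}(H)$ is the bipartite graph on $V(H)\cup E(H)$ with $v\sim h$ iff $v\in h$. Skew zero forcing on a graph $G$: an initial set of vertices is black, the rest white; repeatedly, any vertex $u$ (black or white) with exactly one white neighbor $w$ turns $w$ black. A skew zero forcing set is an initial black set from which all vertices eventually become black; $z_0(G)$ is the minimum size of one. *)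

(* Defs.v *)
From mathcomp Require Import all_boot.

Set Implicit Arguments.
Unset Strict Implicit.
Unset Printing Implicit Defensive.

(* Hyperedges are indexed by a finite type, so that repeated hyperedges (and
   empty ones) are allowed. *)
Record hypergraph := Hypergraph {
  hvertex : finType;
  hedge : finType;
  hset : hedge -> {set hvertex}
}.

Definition dual (H : hypergraph) : hypergraph :=
  @Hypergraph (hedge H) (hvertex H) (fun v => [set h | v \in hset h]).

Definition burn_round (H : hypergraph) (B : {set hvertex H}) :
    {set hvertex H} :=
  B :|: [set v | [exists h : hedge H,
                    (v \in hset h) && (hset h :\ v \subset B)]].

(* By [fconnect_iter] and [iter_findex], [fconnect f x y] holds iff y is
   [iter n f x] for some n; the same finite-reachability device makes both
   "eventually" predicates boolean, as required by [arg min]. *)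
Definition lazy_burning_set (H : hypergraph) (B : {set hvertex H}) : bool :=
  fconnect (@burn_round H) B setT.

Definition lazy_burning_number (H : hypergraph) : nat :=
  #|[arg min_(B < [set: hvertex H] | lazy_burning_set B) #|B|]|.

Record sgraph := SGraph {
  svertex : finType;
  adj : rel svertex;
  adj_sym : symmetric adj;
  adj_irrefl : irreflexive adj
}.

(* One force S -> S', where S is the set of black vertices: the colour of the
   forcing vertex u is irrelevant. *)
Definition skew_force (G : sgraph) : rel {set svertex G} :=
  fun S S' => [exists u : svertex G, exists w : svertex G,
    ([set x | adj u x] :\: S == [set w]) && (S' == w |: S)].

Definition skew_zero_forcing_set (G : sgraph) (S : {set svertex G}) : bool :=
  connect (@skew_force G) S setT.

Definition skew_zero_forcing_number (G : sgraph) : nat :=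
  #|[arg min_(S < [set: svertex G] | skew_zero_forcing_set S) #|S|]|.

Definition incidence (H : hypergraph) : rel (hvertex H + hedge H) :=
  fun x y => match x, y with
             | inl v, inr h | inr h, inl v => v \in hset h
             | _, _ => false
             end.

Lemma incidence_sym (H : hypergraph) : symmetric (@incidence H).
Proof. by move=> [v|h] [w|k]. Qed.

Lemma incidence_irrefl (H : hypergraph) : irreflexive (@incidence H).
Proof. by move=> [v|h]. Qed.

Definition incidence_graph (H : hypergraph) : sgraph :=
  SGraph (@incidence_sym H) (@incidence_irrefl H).

(* Main.v *)
(* In both processes, an initial set fails to spread everywhere exactly when it
   is contained in a proper stalled set.  A set C is stalled for lazy burning
   when no hyperedge has exactly one element outside C, and stalled for skew
   zero forcing when no neighbourhood has exactly one element outside C.  The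
   neighbourhoods of IG(H) are the hyperedges of H, on the vertex side, and
   those of H*, on the hyperedge side, so a set is stalled in IG(H) if and only
   if both of its parts are stalled, in H and in H* respectively. *)

Require Import Defs.
From mathcomp Require Import all_boot.

Set Implicit Arguments.
Unset Strict Implicit.
Unset Printing Implicit Defensive.

(** Stated for an arbitrary indexed family, so that the same notion serves the hyperedges of a
    hypergraph, those of its dual and the neighbourhoods of a graph. *)
Definition stalled (I T : finType) (N : I -> {set T}) (C : {set T}) : bool :=
  [forall i, forall w, N i :\: C != [set w]].

Lemma stalledPn (I T : finType) (N : I -> {set T}) (C : {set T}) :
  reflect (exists i w, N i :\: C = [set w]) (~~ stalled N C).
Proof.
apply: (iffP forallPn) => [[i /forallPn[w]]|[i [w Nw]]].
  by rewrite negbK => /eqP; exists i, w.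
by exists i; apply/forallPn; exists w; rewrite Nw eqxx.
Qed.

Lemma stalled_mem (I T : finType) (N : I -> {set T}) (C : {set T}) i w :
  stalled N C -> w \in N i -> N i :\ w \subset C -> w \in C.
Proof.
move=> stC wN NC; apply: contraLR stC => wC; apply/stalledPn.
exists i, w; apply/setP => x; rewrite !inE.
have [->|xw] := eqVneq x w; first by rewrite wN wC.
apply/negP => /andP[/negP xC xN]; apply: xC.
by apply: (subsetP NC); rewrite !inE xw.
Qed.

(** A path from [S] can never leave a stalled set containing [S], so reaching [setT] forces that set
    to be [setT]. Conversely, a largest set reachable from [S] is stalled, since otherwise [e_grow]
    would enlarge it. *)
Lemma connect_setTP {T : finType} (e : rel {set T}) (st : pred {set T})
    (S : {set T}) :
    (forall A A' C : {set T}, e A A' -> A \subset C -> st C -> A' \subset C) ->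
    (forall C, ~~ st C -> exists2 C', e C C' & C \proper C') ->
  connect e S setT <->
  (forall C : {set T}, S \subset C -> st C -> C = setT).
Proof.
move=> e_sub e_grow; split=> [/connectP[p] | S_top].
  move=> ep eT C SC stC; apply/eqP; rewrite -subTset eT.
  elim: p S ep SC {eT} => //= A p IHp S /andP[eSA pA] SC.
  exact: IHp pA (e_sub _ _ _ eSA SC stC).
(* The inclusion is carried along because [S_top] asks for it and [e] is not assumed to enlarge
   sets. *)
pose P C := connect e S C && (S \subset C).
have PS : P S by rewrite /P connect0 subxx.
case: (arg_maxnP (fun C : {set T} => #|C|) PS) => C /andP[SeC SC] maxC.
suff stC : st C by rewrite -(S_top C SC stC).
apply: contraT => /e_grow[C' eC CC'].
have /maxC : P C'.
  rewrite /P (connect_trans SeC (connect1 eC)).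
  exact: subset_trans SC (proper_sub CC').
by rewrite /= leqNgt proper_card.
Qed.

Lemma lazy_burning_setP (H : hypergraph) (B : {set hvertex H}) :
  lazy_burning_set B <->
  (forall C : {set hvertex H}, B \subset C -> stalled (@hset H) C -> C = setT).
Proof.
apply: connect_setTP => [A _ C /eqP<- AC stC | C /stalledPn[h [v hv]]].
  rewrite subUset AC; apply/subsetP => v.
  rewrite inE => /existsP[h /andP[vh hA]].
  exact: stalled_mem stC vh (subset_trans hA AC).
have /setDP[vh vC] : v \in hset h :\: C by rewrite hv set11.
exists (burn_round C); first by rewrite /= eqxx.
rewrite properE subsetUl; apply: contra vC => /subsetP; apply.
rewrite !inE; apply/orP; right; apply/existsP; exists h; rewrite vh /=.
(* Both [hset h :\ v \subset C] and [hset h :\: C \subset [set v]] say that [hset h] lies in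
   [v |: C]. *)
by rewrite subDset setUC -subDset hv.
Qed.

Lemma skew_zero_forcing_setP (G : sgraph) (S : {set svertex G}) :
  skew_zero_forcing_set S <->
  (forall C : {set svertex G}, S \subset C ->
     stalled (fun u => [set x | adj u x]) C -> C = setT).
Proof.
apply: connect_setTP => [A A' C | C /stalledPn[u [w uw]]].
  move=> /existsP[u /existsP[w /andP[/eqP uw /eqP->]]] AC stC.
  rewrite subUset AC sub1set andbT.
  have /setDP[wu _] : w \in [set x | adj u x] :\: A by rewrite uw set11.
  apply: stalled_mem stC wu _.
  (* As [A \subset C], at most [w] is left of the neighbourhood of [u] outside [C]. *)
  by rewrite subDset setUC -subDset (subset_trans (setDS _ AC)) ?uw.
have /setDP[_ wC] : w \in [set x | adj u x] :\: C by rewrite uw set11.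
exists (w |: C); last by rewrite setUC properUl // sub1set.
by apply/existsP; exists u; apply/existsP; exists w; rewrite uw !eqxx.
Qed.

(** The body is spelled as the union in the final theorem, so that results on [sum_set] apply there
    by mere unfolding. *)
Definition sum_set (T U : finType) (A : {set T}) (B : {set U}) : {set T + U} :=
  [set inl x | x in A] :|: [set inr y | y in B].

Lemma in_sum_set (T U : finType) (A : {set T}) (B : {set U}) z :
  (z \in sum_set A B) = match z with inl x => x \in A | inr y => y \in B end.
Proof.
rewrite inE; case: z => [x|y].
  rewrite (mem_imset _ _ (@inl_inj T U)) orbC.
  by case: imsetP => // -[].
rewrite (mem_imset _ _ (@inr_inj T U)).
by case: imsetP => // -[].
Qed.

Lemma sum_set_preim (T U : finType) (S : {set T + U}) :
  sum_set (inl @^-1: S) (inr @^-1: S) = S.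
Proof. by apply/setP => -[x|y]; rewrite in_sum_set inE. Qed.

Lemma sum_set_subset (T U : finType) (A A' : {set T}) (B B' : {set U}) :
  (sum_set A B \subset sum_set A' B') = (A \subset A') && (B \subset B').
Proof.
apply/subsetP/andP => [sub | [/subsetP sA /subsetP sB] [x|y]].
- split; apply/subsetP => x xA.
    by have := sub (inl x); rewrite !in_sum_set; apply.
  by have := sub (inr x); rewrite !in_sum_set; apply.
- by rewrite !in_sum_set; apply: sA.
- by rewrite !in_sum_set; apply: sB.
Qed.

Lemma sum_setT (T U : finType) : sum_set [set: T] [set: U] = setT.
Proof. by apply/setP => -[x|y]; rewrite in_sum_set !inE. Qed.

Lemma card_sum_set (T U : finType) (A : {set T}) (B : {set U}) :
  #|sum_set A B| = #|A| + #|B|.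
Proof.
rewrite cardsU (card_imset _ (@inl_inj T U)) (card_imset _ (@inr_inj T U)).
suff -> : [set inl x | x in A] :&: [set inr y | y in B] = set0 :> {set T + U}.
  by rewrite cards0 subn0.
by apply/setP => z; rewrite !inE; apply/andP => -[/imsetP[x _ ->] /imsetP[]].
Qed.

Lemma set1_inl_sum_set (T U : finType) (x : T) :
  [set inl x] = sum_set [set x] set0 :> {set T + U}.
Proof. by apply/setP => -[y|y]; rewrite in_sum_set !inE. Qed.

Lemma set1_inr_sum_set (T U : finType) (y : U) :
  [set inr y] = sum_set set0 [set y] :> {set T + U}.
Proof. by apply/setP => -[x|x]; rewrite in_sum_set !inE. Qed.

Lemma sum_set_inj (T U : finType) (A A' : {set T}) (B B' : {set U}) :
  sum_set A B = sum_set A' B' -> A = A' /\ B = B'.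
Proof.
move=> /eqP; rewrite eqEsubset !sum_set_subset => /andP[/andP[? ?] /andP[? ?]].
by split; apply/eqP; rewrite eqEsubset; apply/andP.
Qed.

Lemma incidence_setD_inl (H : hypergraph) (v : hvertex H) A As :
  [set x | @adj (incidence_graph H) (inl v) x] :\: sum_set A As =
  sum_set set0 (@hset (dual H) v :\: As).
Proof. by apply/setP => -[w|h]; rewrite !(in_sum_set, inE) ?andbF. Qed.

Lemma incidence_setD_inr (H : hypergraph) (h : hedge H) A As :
  [set x | @adj (incidence_graph H) (inr h) x] :\: sum_set A As =
  sum_set (hset h :\: A) set0.
Proof. by apply/setP => -[w|k]; rewrite !(in_sum_set, inE) ?andbF. Qed.

Lemma stalled_incidence (H : hypergraph) (A : {set hvertex H})
    (As : {set hedge H}) :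
  stalled (fun u => [set x | @adj (incidence_graph H) u x]) (sum_set A As) =
  stalled (@hset H) A && stalled (@hset (dual H)) As.
Proof.
apply: negb_inj; rewrite negb_and.
apply/stalledPn/orP => [[[v|h] [[w|k]]]|[] /stalledPn].
(* IG(H) is bipartite: a neighbourhood has elements on one side only, so a singleton on the other
   side would make [set0] a singleton. *)
- rewrite incidence_setD_inl set1_inl_sum_set => /sum_set_inj[/setP/(_ w)].
  by rewrite !inE eqxx.
- rewrite incidence_setD_inl set1_inr_sum_set => /sum_set_inj[_ vk].
  by right; apply/stalledPn; exists v, k.
- rewrite incidence_setD_inr set1_inl_sum_set => /sum_set_inj[hw _].
  by left; apply/stalledPn; exists h, w.
- rewrite incidence_setD_inr set1_inr_sum_set => /sum_set_inj[_ /setP/(_ k)].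
  by rewrite !inE eqxx.
- move=> [h [w hw]]; exists (inr h), (inl w).
  by rewrite incidence_setD_inr hw set1_inl_sum_set.
- move=> [v [k vk]]; exists (inl v), (inr k).
  by rewrite incidence_setD_inl vk set1_inr_sum_set.
Qed.

Lemma skew_zero_forcing_incidence (H : hypergraph) (B : {set hvertex H})
    (Bs : {set hedge H}) :
  (lazy_burning_set B /\ @lazy_burning_set (dual H) Bs) <->
  @skew_zero_forcing_set (incidence_graph H) (sum_set B Bs).
Proof.
split=> [[/lazy_burning_setP topB /lazy_burning_setP topBs]|].
  apply/skew_zero_forcing_setP => C.
  rewrite -[C]sum_set_preim sum_set_subset.
  rewrite stalled_incidence => /andP[BC BsC] /andP[stC stCs].
  by rewrite (topB _ BC stC) (topBs _ BsC stCs) sum_setT.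
move=> /skew_zero_forcing_setP top.
have stT (I T : finType) (N : I -> {set T}) : stalled N setT.
  by apply/forallP => i; apply/forallP => w; rewrite setDT eq_sym -cards_eq0 cards1.
(* Pairing [C] with the full set on the other side, which is always stalled, isolates one of the two
   processes. *)
split; apply/lazy_burning_setP => C BC stC.
  have := top (sum_set C setT); rewrite sum_set_subset BC subsetT.
  rewrite stalled_incidence stC stT -sum_setT => /(_ isT isT).
  by case/sum_set_inj.
have := top (sum_set setT C); rewrite sum_set_subset BC subsetT.
rewrite stalled_incidence stC stT -sum_setT => /(_ isT isT).
by case/sum_set_inj.
Qed.

Lemma lazy_burning_numberP (H : hypergraph) :
  (exists2 B : {set hvertex H},
     lazy_burning_set B & #|B| = lazy_burning_number H) /\
  (forall B : {set hvertex H}, lazy_burning_set B ->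
     lazy_burning_number H <= #|B|).
Proof.
rewrite /lazy_burning_number.
(* The default value [setT] burns by the empty path, so the [arg min] is a true minimum. *)
case: arg_minnP => [|B burnB minB]; first exact: connect0.
by split=> //; exists B.
Qed.

Lemma skew_zero_forcing_numberP (G : sgraph) :
  (exists2 S : {set svertex G},
     skew_zero_forcing_set S & #|S| = skew_zero_forcing_number G) /\
  (forall S : {set svertex G}, skew_zero_forcing_set S ->
     skew_zero_forcing_number G <= #|S|).
Proof.
rewrite /skew_zero_forcing_number.
case: arg_minnP => [|S forceS minS]; first exact: connect0.
by split=> //; exists S.
Qed.

Theorem theorem4p9 (H : hypergraph) :
  (forall (B : {set hvertex H}) (Bstar : {set hedge H}),
     (lazy_burning_set B /\ @lazy_burning_set (dual H) Bstar) <->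
     @skew_zero_forcing_set (incidence_graph H)
       ([set inl v | v in B] :|: [set inr h | h in Bstar]))
  /\ skew_zero_forcing_number (incidence_graph H)
     = lazy_burning_number H + lazy_burning_number (dual H).
Proof.
split; first exact: skew_zero_forcing_incidence.
have [[B burnB cardB] minB] := lazy_burning_numberP H.
have [[Bs burnBs cardBs] minBs] := lazy_burning_numberP (dual H).
have [[S forceS cardS] minS] := skew_zero_forcing_numberP (incidence_graph H).
apply/eqP; rewrite eqn_leq; apply/andP; split.
  (* Two minimum lazy burning sets combine into a skew zero forcing set. *)
  rewrite -cardB -cardBs -card_sum_set; apply: minS.
  exact/skew_zero_forcing_incidence.
(* Conversely, the two sides of a minimum skew zero forcing set are lazy burning sets. *)
move: forceS; rewrite -cardS -[S]sum_set_preim card_sum_set.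
by move=> /skew_zero_forcing_incidence[? ?]; rewrite leq_add ?minB ?minBs.
Qed.
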